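(* Let $p$ be a prime and let $f\in\mathbb{F}_p[X^{\pm1},Y^{\pm1}]$ be a non-zero Laurent polynomial whose line polynomial factors are all in the same direction (this includes the case where $f$ has no line polynomial factors). Let $c\in X_f$, i.e. $c\in\mathbb{F}_p[[X^{\pm1},Y^{\pm1}]]$ with $fc=0$. If $c$ has low complexity, then $c$ is periodic.
   Context: All polynomials are Laurent polynomials. $\mathbb{F}_p[[X^{\pm1},Y^{\pm1}]]$ is the set of formal two-sided power series $c=\sum_{(i,j)\in\mathbb{Z}^2}c_{i,j}X^iY^j$ (equivalently, configurations $c\in\mathbb{F}_p^{\mathbb{Z}^2}$), a module over $\mathbb{F}_p[X^{\pm1},Y^{\pm1}]$ under the formal product. For a non-zero $f$, $X_f=\{c\in\mathbb{F}_p[[X^{\pm1},Y^{\pm1}]] : fc=0\}$. For $f=\sum a_{i,j}X^iY^j$, $\mathrm{supp}(f)=\{(i,j): a_{i,j}\neq0\}$. A Laurent polynomial is a line polynomial in direction $\mathbf{u}\in\mathbb{Z}^2\setminus\{\mathbf{0}\}$ if its support contains at least two elements and is contained in $\{\mathbf{n}+r\mathbf{u} : r\in\mathbb{Q}\}$ for some $\mathbf{n}\in\mathbb{Z}^2$. Directions that are non-zero rational multiples of each other are the same. A line polynomial factor of $f$ is a line polynomial dividing $f$ in $\mathbb{F}_p[X^{\pm1},Y^{\pm1}]$. The translation by $\mathbf{t}\in\mathbb{Z}^2$ is $\tau_{\mathbf{t}}(c)_{\mathbf{n}}=c_{\mathbf{n}-\mathbf{t}}$. A configuration $c$ is periodic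 if $\tau_{\mathbf{t}}(c)=c$ for some non-zero $\mathbf{t}\in\mathbb{Z}^2$. For a finite $D\subset\mathbb{Z}^2$, $P(c,D)=\{\tau_{\mathbf{t}}(c)_{|D} : \mathbf{t}\in\mathbb{Z}^2\}$ is the set of $D$-patterns of $c$. The configuration $c$ has low complexity if $|P(c,D)|\le|D|$ for some finite $D\subset\mathbb{Z}^2$ (of any shape). *)

(* Defs.v *)
From mathcomp Require Import all_boot all_order all_algebra.
From mathcomp Require Import finmap boolp.

Set Implicit Arguments.
Unset Strict Implicit.
Unset Printing Implicit Defensive.

Import GRing.Theory.

Local Open Scope ring_scope.

Notation Z2 := (int * int)%type.

Section Definitions.
Variable p : nat.

(* The coefficient of X^i Y^j is the value at (i, j); [finsupp f] is supp(f). *)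
Definition laurent := {fsfun Z2 -> 'F_p with 0}.

Definition laurent0 : laurent := [fsfun for fun=> 0].

Definition config := Z2 -> 'F_p.

Definition formal_mul (f : laurent) (c : config) : config :=
  fun n => \sum_(k <- finsupp f) f k * c (n - k).

(* The product of Laurent polynomials is the formal product, restricted to the
   Minkowski sum of the supports, outside which it vanishes (see
   [laurent_mulE]). *)
Definition laurent_mul (f g : laurent) : laurent :=
  [fsfun n in [fset (a + b)%R | a in finsupp f, b in finsupp g]%fset
     => formal_mul f g n | 0].

Lemma laurent_mulE (f g : laurent) (n : Z2) :
  laurent_mul f g n = formal_mul f g n.
Proof.
rewrite fsfunE; case: ifPn => // nfg; symmetry; rewrite /formal_mul.
rewrite big_seq big1 // => k kf; rewrite (fsfun_dflt (f := g)) ?mulr0 //.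
apply: contra nfg => nkg; apply/imfset2P; exists k => //; exists (n - k) => //.
by rewrite addrC subrK.
Qed.

Definition laurent_dvd (g f : laurent) : Prop :=
  exists h : laurent, f = laurent_mul g h.

Definition solution_space (f : laurent) (c : config) : Prop :=
  forall n, formal_mul f c n = 0.

Definition on_line (n u m : Z2) : Prop :=
  exists r : rat, m.1%:Q = n.1%:Q + r * u.1%:Q /\ m.2%:Q = n.2%:Q + r * u.2%:Q.

Definition line_polynomial (u : Z2) (g : laurent) : Prop :=
  [/\ u != 0, (2 <= #|` finsupp g|)%N
    & exists n : Z2, forall m, m \in finsupp g -> on_line n u m].

Definition same_direction (u v : Z2) : Prop :=
  exists r : rat,
    [/\ r != 0, v.1%:Q = r * u.1%:Q & v.2%:Q = r * u.2%:Q].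

Definition line_factor (f : laurent) (u : Z2) (g : laurent) : Prop :=
  line_polynomial u g /\ laurent_dvd g f.

Definition line_factors_same_direction (f : laurent) : Prop :=
  forall (u v : Z2) (g h : laurent),
    line_factor f u g -> line_factor f v h -> same_direction u v.

Definition translate (t : Z2) (c : config) : config := fun n => c (n - t).

Definition periodic (c : config) : Prop :=
  exists2 t : Z2, t != 0 & translate t c =1 c.

Definition pattern_at (c : config) (D : {fset Z2}) (t : Z2) :
    {ffun D -> 'F_p} :=
  [ffun d : D => translate t c (val d)].

Definition patterns (c : config) (D : {fset Z2}) : {set {ffun D -> 'F_p}} :=
  [set s : {ffun D -> 'F_p} | `[< exists t : Z2, s = pattern_at c D t >]].

Definition low_complexity (c : config) : Prop :=
  exists D : {fset Z2}, (#|patterns c D| <= #|` D|)%N.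

End Definitions.

(* Main.v *)
Require Import Defs.
From mathcomp Require Import all_boot all_order all_algebra.
From mathcomp Require Import finmap boolp.
From mathcomp Require Import ring zify.

(* Lift [c] to a bounded integer configuration.  Low complexity gives, by linear
   algebra, a non-trivial integer relation [sum_i a_i c(n - v_i) = const], which
   becomes a relation with constant 0 for a difference of [c].  As [P(X^q)] is
   congruent to [P(X)^q] modulo a prime [q] and the values are bounded, the
   relation survives the dilation of all [v_i] by any large prime [q], hence by
   [1 + r k] for a fixed [r] and all [k].  Eliminating as for a Vandermonde
   system, [c] is annihilated by a product of differences [X^w - 1], [w != 0],
   over the integers and therefore modulo [p].

   Let [u] be the common direction of the line factors of [f].  The differences
   are removed one at a time, each at the price of a factor [X^(b u) - 1]: a
   [w]-periodic solution of [f] has a period [b u] trivially if [w] is parallel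
   to [u]; otherwise [f] has no factor in common with [X^w - 1], and in
   coordinates adapted to [w] the ideal [<f, X^w - 1>] contains some
   [Y^a (Y^b - 1)] because the ground field is finite.  Finally
   [(X^v - 1)^p = X^(p v) - 1] collapses a product of two differences along [u]
   into a single one. *)

Set Implicit Arguments.
Unset Strict Implicit.
Unset Printing Implicit Defensive.
Import Order.TTheory GRing.Theory Num.Theory.
Local Open Scope ring_scope.

(** * Periods and differences *)

Section Differences.
Variables G V : zmodType.
Implicit Types (d : G -> V) (v w n : G).

Definition period w d := forall n, d (n - w) = d n.
Definition diff w d : G -> V := fun n => d (n - w) - d n.
Definition diffs ws d := foldl (fun d w => diff w d) d ws.

Lemma diffC v w d : diff v (diff w d) = diff w (diff v d).
Proof.
apply/funext => n; rewrite /diff (addrAC n) !opprD !opprK !addrA.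
by rewrite (addrAC (d (n - w - v))).

Qed.

Lemma diffs_diff ws w d : diffs ws (diff w d) = diff w (diffs ws d).
Proof. by elim: ws d => //= v ws IH d; rewrite -IH diffC. Qed.

Lemma periodP w d : period w d <-> diff w d =1 fun=> 0.
Proof.
by split=> H n; [rewrite /diff H subrr | apply/eqP; rewrite -subr_eq0; apply/eqP/H].
Qed.

Lemma periodD v w d : period v d -> period w d -> period (v + w) d.
Proof. by move=> dv dw n; rewrite opprD addrA dw dv. Qed.

Lemma periodN w d : period w d -> period (- w) d.
Proof. by move=> dw n; rewrite -[LHS]dw opprK addrK. Qed.

Lemma periodMn w d k : period w d -> period (w *+ k) d.
Proof.
move=> dw; elim: k => [n|k IH]; first by rewrite mulr0n subr0.
by rewrite mulrS; apply: periodD.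
Qed.

Lemma periodMz w d z : period w d -> period (w *~ z) d.
Proof.
by move=> dw; case: z => k; [|rewrite NegzE mulrNz; apply: periodN];
   rewrite -pmulrn; apply: periodMn.
Qed.

(** Along each [w]-orbit [d] is an arithmetic progression, so in characteristic [p] it returns to
    its value after [p] steps. *)
Lemma period_diff_char p w d : (forall x : V, x *+ p = 0) ->
  period w (diff w d) -> period (w *+ p) d.
Proof.
move=> charp dw n; suff -> k : d (n - w *+ k) = d n + diff w d n *+ k.
  by rewrite charp addr0.
elim: k => [|k IH]; first by rewrite !mulr0n subr0 addr0.
rewrite [w *+ _]mulrSr opprD addrA mulrS addrCA -IH.
by rewrite -(periodMn k dw n) /diff subrK.
Qed.

(** [Q] stands for solving a fixed equation; it survives differences, so the hypothesis on periodic
    solutions applies at every stage of the induction on [ws]. *)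
Lemma diffs_period p (Q : (G -> V) -> Prop) (u : G) (ws : seq G) d :
    (0 < p)%N -> (forall x : V, x *+ p = 0) ->
    (forall w c, Q c -> Q (diff w c)) ->
    (forall w c, w \in ws -> Q c -> period w c ->
       exists2 b, (0 < b)%N & period (u *+ b) c) ->
  Q d -> diffs ws d =1 (fun=> 0) -> exists2 b, (0 < b)%N & period (u *+ b) d.
Proof.
move=> p0 charp Qdiff; elim: ws d => [|w ws IH] d Qper Qd /= d0.
  by exists 1%N => // n; rewrite !d0.
have [|b b0 /periodP db] := IH _ _ (Qdiff w d Qd) d0.
  by move=> v c vws; apply: Qper; rewrite inE vws orbT.
have /periodP dw : diff w (diff (u *+ b) d) =1 fun=> 0 by rewrite diffC.
have [|b' b'0 /periodP] := Qper _ _ _ (Qdiff _ _ Qd) dw; first by rewrite inE eqxx.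
(* Both differences along [u] are lengthened to the common multiple [b * b'], as [period_diff_char]
   needs two equal ones. *)
rewrite diffC => /periodP /(periodMn b'); rewrite -mulrnA => /periodP.
rewrite diffC => /periodP /(periodMn b); rewrite -mulrnA (mulnC b') => db'.
exists (b * b' * p)%N; first by rewrite !muln_gt0 b0 b'0.
by rewrite mulrnA; apply: period_diff_char.
Qed.

(* Subtracting from the relation for [k + 1], shifted by [t'], the one for [k]
   removes the term [(d', t')]. *)
Lemma vandermonde_elimination (S : seq ((G -> V) * G)) d t :
    (forall k n, d (n - t *+ k) + \sum_(x <- S) x.1 (n - x.2 *+ k) = 0) ->
  diffs [seq t - x.2 | x <- S] d =1 fun=> 0.
Proof.
move: {2}(size S) (erefl (size S)) => m; elim: m S d => [|m IH] [|[d' t'] S] d //=.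
  by move=> _ H n; have := H 0%N n; rewrite big_nil addr0 mulr0n subr0.
case=> Sm H; set S' := [seq (diff (x.2 - t') x.1, x.2) | x <- S].
have -> : [seq t - x.2 | x <- S] = [seq t - x.2 | x <- S'].
  by rewrite -map_comp.
apply: IH; first by rewrite size_map.
have shift (c : G -> V) v k n : diff (v - t') c (n - v *+ k) =
    c (n + t' - v *+ k.+1) - c (n - v *+ k).
  by rewrite /diff opprB addrACA mulrS opprD [in RHS](addrC (- v)).
move=> k n; rewrite big_map shift.
under eq_bigr do rewrite /= shift.
rewrite sumrB addrACA -opprD.
have := H k.+1 (n + t'); have := H k n; rewrite !big_cons /=.
have -> : n + t' - t' *+ k.+1 = n - t' *+ k by rewrite mulrS opprD addrA addrK.
rewrite addrCA => /(canRL (addKr _)) ->; rewrite addr0.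
by rewrite addrCA => /(canRL (addKr _)) ->; rewrite addr0 subrr.
Qed.

End Differences.

(** * Elimination over a finite field *)

Section Elimination.
Variable F : finFieldType.
Implicit Types (P D : {poly F}) (Q N : {poly {poly F}}).

(** The ideal generated by [Q] and [P] in F[X][Y], where [P] involves only the inner variable X. *)
Definition in_ideal Q P N := exists A B, N = A * Q + B * P%:P.

Lemma in_idealMl Q P A N : in_ideal Q P N -> in_ideal Q P (A * N).
Proof. by move=> [B [C ->]]; exists (A * B), (A * C); rewrite mulrDr !mulrA. Qed.

Lemma in_idealM Q P D N N' :
  in_ideal Q P N -> in_ideal Q D N' -> in_ideal Q (P * D) (N * N').
Proof.
move=> [A [B ->]] [A' [B' ->]].
by exists (A * (A' * Q + B' * D%:P) + B * P%:P * A'), (B * B'); rewrite polyCM; ring.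
Qed.

Lemma in_ideal_trans Q Q' P N : in_ideal Q P Q' -> in_ideal Q' P N -> in_ideal Q P N.
Proof.
by move=> [A [B ->]] [A' [B' ->]]; exists (A' * A), (A' * B + B'); ring.
Qed.

Lemma polyCM_of_dvdp P Q : (forall j, P %| Q`_j) ->
  Q = P%:P * map_poly (fun c => c %/ P) Q.
Proof.
move=> PQ; apply/polyP => j.
by rewrite coefCM coef_map_id0 ?div0p // mulrC divpK.
Qed.

(* Modulo a monic [Q] and a non-zero [P] there are finitely many residues. *)
Lemma monic_in_ideal Q P : Q \is monic -> P != 0 ->
  exists a b, (0 < b)%N /\ in_ideal Q P ('X^a * ('X^b - 1)).
Proof.
move=> Qm P0.
pose r n := Pdiv.Ring.rmodp 'X^n Q.
(* Finitely many coefficients in [F] record the residue of Y^n modulo [Q] and [P], so two powers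
   share a code by pigeonhole. *)
pose code n : {ffun 'I_(size Q) * 'I_(size P) -> F} :=
  [ffun x : 'I_(size Q) * 'I_(size P) => ((r n)`_x.1 %% P)`_x.2].
pose M := #|{: {ffun 'I_(size Q) * 'I_(size P) -> F}}|.
have [m [n [ltmn eqmn]]] : exists m n, (m < n)%N /\ code m = code n.
  have /injectivePn : ~~ injectiveb (fun i : 'I_M.+1 => code i).
    by apply/negP => /injectiveP /leq_card; rewrite card_ord ltnn.
  move=> [i [j ij eqij]]; move: ij; rewrite neq_ltn => /orP[ij|ij].
    by exists i, j.
  by exists j, i.
have rP j : P %| (r n - r m)`_j.
  rewrite coefB; apply/modp_eq0P; rewrite modpD modpN.
  suff -> : (r n)`_j %% P = (r m)`_j %% P by rewrite subrr.
  have [jQ|jQ] := ltnP j (size Q); last first.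
    by rewrite !nth_default // (leq_trans _ jQ) // ltnW //
      Pdiv.Ring.ltn_rmodpN0 // monic_neq0.
  apply/polyP => i; have [iP|iP] := ltnP i (size P); last first.
    have mod0 q : (q %% P)`_i = 0.
      by rewrite nth_default // (leq_trans _ iP) // ltnW // ltn_modp.
    by rewrite !mod0.
  by move/ffunP/(_ (Ordinal jQ, Ordinal iP)): eqmn; rewrite !ffunE.
exists m, (n - m)%N; split; first by rewrite subn_gt0.
exists (Pdiv.Ring.rdivp 'X^n Q - Pdiv.Ring.rdivp 'X^m Q),
  (map_poly (fun c => c %/ P) (r n - r m)).
rewrite mulrBr mulr1 -exprD subnKC ?(ltnW ltmn) // (mulrC (map_poly _ _)).
rewrite -polyCM_of_dvdp //.
rewrite {1}(Pdiv.RingMonic.rdivp_eq Qm 'X^n) {1}(Pdiv.RingMonic.rdivp_eq Qm 'X^m).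
by rewrite -/(r n) -/(r m); ring.
Qed.

(** Induction on the size of [P], with the coefficients of [Q] reduced modulo [P]. A leading
    coefficient coprime to [P] can be made 1, and [monic_in_ideal] applies; otherwise its gcd with
    [P] splits [P] into two smaller factors, whose ideal members are multiplied. *)
Lemma common_factor_or_in_ideal p P Q : p \in [pchar F] -> P != 0 ->
  (exists D G, [/\ (1 < size D)%N, D %| P & Q = D%:P * G]) \/
  (exists a b, (0 < b)%N /\ in_ideal Q P ('X^a * ('X^b - 1))).
Proof.
move=> charF; have [m] := ubnP (size P); elim: m P => // m IH P /ltnSE lePm P0.
have [P1|P1] := leqP (size P) 1.
  (* A non-zero constant [P] is a unit, so the ideal is the whole ring. *)
  right; exists 0%N, 1%N; split => //.
  have := size1_polyC P1; set c := P`_0 => Pc.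
  have c0 : c != 0 by apply: contraNneq P0 => c0; rewrite Pc c0.
  exists 0, (('X - 1) * c^-1%:P%:P); rewrite mul0r add0r -mulrA -polyCM Pc -polyCM.
  by rewrite mulVf // mulr1 expr0 mul1r expr1.
case: (pselect (forall j, P %| Q`_j)) => [PQ|nPQ].
  by left; exists P, (map_poly (fun c => c %/ P) Q); split=> //; apply: polyCM_of_dvdp.
pose Q1 := map_poly (fun c => c %% P) Q; pose Q2 := map_poly (fun c => c %/ P) Q.
have QE : Q1 = Q - Q2 * P%:P.
  apply/polyP => j; rewrite coefB coefMC !coef_map_id0 ?mod0p ?div0p //.
  by rewrite {2}(divp_eq Q`_j P) addrC addKr.
have Q10 : Q1 != 0.
  apply/eqP => Q10; apply: nPQ => j; apply/modp_eq0P.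
  by have := congr1 (fun q : {poly {poly F}} => q`_j) Q10;
     rewrite coef_map_id0 ?mod0p ?coef0.
set l := lead_coef Q1.
have l0 : l != 0 by rewrite lead_coef_eq0.
have ltlP : (size l < size P)%N.
  by rewrite /l lead_coefE coef_map_id0 ?mod0p // ltn_modp.
have [colP|ncolP] := boolP (coprimep l P).
  right.
  have /Bezout_eq1_coprimepP [[u v] /= uv1] := colP.
  pose k := (size Q1).-1.
  (* As [u * l + v * P = 1], the multiple of [P] added in degree [k] turns the leading coefficient
     [u * l] into 1. *)
  pose Q3 := u%:P * Q1 + (v * P)%:P * 'X^k.
  have Q3k : Q3`_k = 1 by rewrite coefD !coefCM coefXn eqxx mulr1 -/l -uv1.
  have sQ3 : (size Q3 <= k.+1)%N.
    apply/leq_sizeP => j kj; rewrite coefD !coefCM coefXn gtn_eqF // mulr0 addr0.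
    by rewrite nth_default ?mulr0 // (leq_trans _ kj) // leqSpred.
  have Q3m : Q3 \is monic.
    rewrite monicE lead_coefE; suff -> : size Q3 = k.+1 by rewrite /= Q3k.
    apply/eqP; rewrite eqn_leq sQ3 ltnNge; apply/negP => /leq_sizeP/(_ k (leqnn k)).
    by rewrite Q3k => /eqP; rewrite oner_eq0.
  have [a [b [b0 ab]]] := monic_in_ideal Q3m P0.
  exists a, b; split => //; apply: in_ideal_trans ab.
  have step (U V W : {poly {poly F}}) : in_ideal Q P (U * (Q - W * P%:P) + V * P%:P).
    by exists U, (V - U * W); ring.
  by rewrite /Q3 QE polyCM mulrAC; apply: step.
set D := gcdp l P in ncolP *; have DP : D %| P := dvdp_gcdr _ _.
have D0 : D != 0 by rewrite gcdp_eq0 (negPf l0).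
have D1 : (1 < size D)%N.
  by rewrite ltn_neqAle eq_sym ncolP lt0n size_poly_eq0.
have ltDP : (size D < size P)%N.
  by rewrite (leq_ltn_trans _ ltlP) // dvdp_leq // dvdp_gcdl.
have EP : P = (P %/ D) * D by rewrite divpK.
set E := P %/ D in EP.
have E0 : E != 0 by apply: contraNneq P0 => E0; rewrite EP E0 mul0r.
have ltEP : (size E < size P)%N.
  rewrite EP size_mul // -ltnS prednK; last by rewrite addn_gt0 lt0n size_poly_eq0 E0.
  by rewrite -[X in (X < _)%N]addn1 ltn_add2l.
have [[A [B [A1 AD QB]]]|[a [b [b0 ab]]]] := IH D (leq_trans ltDP lePm) D0.
  by left; exists A, B; split=> //; apply: dvdp_trans AD DP.
have [[A [B [A1 AE QB]]]|[a' [b' [b'0 ab']]]] := IH E (leq_trans ltEP lePm) E0.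
  by left; exists A, B; split=> //; rewrite EP dvdp_mulr.
(* Y^b - 1 and Y^b' - 1 both divide Y^(b b') - 1, so their product divides its square and, as [p] is
   at least 2, its [p]-th power Y^(b b' p) - 1. *)
right; exists (a + a')%N, (b * b' * p)%N.
have pp := pcharf_prime charF.
split; first by rewrite !muln_gt0 b0 b'0 prime_gt0.
have charFF : p \in [pchar {poly {poly F}}] by rewrite !pchar_poly.
have -> : 'X^(b * b' * p) - 1 = ('X^(b * b') - 1) ^+ p :> {poly {poly F}}.
  rewrite -(pFrobenius_autE charFF) pFrobenius_autB_comm; last exact: mulrC.
  by rewrite pFrobenius_aut1 pFrobenius_autE exprM.
rewrite -{1}(subnK (prime_gt1 pp)) (exprD _ (p - 2)).
have -> : 'X^(a + a') * (('X^(b * b') - 1) ^+ (p - 2) * ('X^(b * b') - 1) ^+ 2) =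
  (('X^(b * b') - 1) ^+ (p - 2) * (\sum_(i < b') ('X^b) ^+ i) * (\sum_(i < b) ('X^b') ^+ i))
   * (('X^a' * ('X^b' - 1)) * ('X^a * ('X^b - 1))) :> {poly {poly F}}.
  have Z1 : 'X^(b * b') - 1 = ('X^b - 1) * \sum_(i < b') ('X^b) ^+ i :> {poly {poly F}}.
    by rewrite exprM subrX1.
  have Z2 : 'X^(b * b') - 1 = ('X^b' - 1) * \sum_(i < b) ('X^b') ^+ i :> {poly {poly F}}.
    by rewrite mulnC exprM subrX1.
  have -> : ('X^(b * b') - 1) ^+ 2 = (('X^b - 1) * \sum_(i < b') ('X^b) ^+ i) *
      (('X^b' - 1) * \sum_(i < b) ('X^b') ^+ i) :> {poly {poly F}}.
    by rewrite -Z1 -Z2 expr2.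
  have comb (R : comPzRingType) (r u1 u2 v1 v2 s1 s2 : R) :
    u1 * u2 * (r * (v1 * s1 * (v2 * s2))) = r * s1 * s2 * (u2 * v2 * (u1 * v1)) by ring.
  by rewrite exprD comb.
by apply: in_idealMl; rewrite EP; apply: in_idealM.
Qed.

End Elimination.

(** * Polynomials acting on configurations *)

Section CoefficientSums.
Variables (S : nzRingType) (V : zmodType) (g : nat -> S -> V).
Hypothesis g0 : forall i, g i 0 = 0.

Lemma sum_coef_widen (q : {poly S}) N : (size q <= N)%N ->
  \sum_(i < size q) g i q`_i = \sum_(i < N) g i q`_i.
Proof.
move=> qN; rewrite (big_ord_widen _ (fun i => g i q`_i) qN) big_mkcond.
by apply: eq_bigr => i _; case: ltnP => // /leq_sizeP ->.
Qed.

Lemma sum_coefD (q r : {poly S}) :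
    (forall i x y, g i (x + y) = g i x + g i y) ->
  \sum_(i < size (q + r)) g i (q + r)`_i =
  \sum_(i < size q) g i q`_i + \sum_(i < size r) g i r`_i.
Proof.
move=> gD; pose N := maxn (size q) (size r).
rewrite (sum_coef_widen (size_polyD q r)) (@sum_coef_widen q N) ?leq_maxl //.
rewrite (@sum_coef_widen r N) ?leq_maxr // -big_split.
by apply: eq_bigr => i _; rewrite coefD gD.
Qed.

Lemma sum_coefMX (q : {poly S}) :
  \sum_(i < size (q * 'X)) g i (q * 'X)`_i = \sum_(i < size q) g i.+1 q`_i.
Proof.
rewrite (@sum_coef_widen _ (size q).+1); last first.
  by apply: leq_trans (size_polyMleq _ _) _; rewrite size_polyX addn2.
rewrite big_ord_recl coefMX /= g0 add0r.
by apply: eq_bigr => i _; rewrite coefMX.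
Qed.

End CoefficientSums.

Section Action.
Variables (R : comNzRingType) (G : zmodType) (e1 e2 : G).
Implicit Types (P Q : {poly {poly R}}) (c : {poly R}) (d : G -> R) (n : G).

(** The inner variable X acts as translation by [e1], the outer variable Y as translation by
    [e2]. *)
Definition act P d : G -> R := fun n =>
  \sum_(j < size P) \sum_(i < size P`_j) P`_j`_i * d (n - (e1 *+ i + e2 *+ j)).

Let g d n j c := \sum_(i < size c) c`_i * d (n - (e1 *+ i + e2 *+ j)).

Let g0 d n j : g d n j 0 = 0.
Proof. by rewrite /g size_poly0 big_ord0. Qed.

Let gD d n j c c' : g d n j (c + c') = g d n j c + g d n j c'.
Proof.
rewrite /g (@sum_coefD _ _ (fun i x => x * d (n - (e1 *+ i + e2 *+ j)))) //.
  by move=> i; rewrite mul0r.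
by move=> i x y; rewrite mulrDl.
Qed.

Let gMX d n j c : g d n j ('X * c) = g d (n - e1) j c.
Proof.
rewrite mulrC /g (@sum_coefMX _ _ (fun i x => x * d (n - (e1 *+ i + e2 *+ j)))).
  by apply: eq_bigr => i _; rewrite mulrS -addrA [in LHS]opprD addrA.
by move=> i; rewrite mul0r.
Qed.

Let gC d n j a c : g d n j (a%:P * c) = a * g d n j c.
Proof.
rewrite /g (@sum_coef_widen _ _ (fun i x => x * d (n - (e1 *+ i + e2 *+ j))) _ _ (size c)).
- by rewrite mulr_sumr; apply: eq_bigr => i _; rewrite coefCM mulrA.
- by move=> i; rewrite mul0r.
by apply/leq_sizeP => i ci; rewrite coefCM nth_default ?mulr0.
Qed.

Lemma act0 d n : act 0 d n = 0.
Proof. by rewrite /act size_poly0 big_ord0. Qed.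

Lemma actD P Q d n : act (P + Q) d n = act P d n + act Q d n.
Proof. exact: (sum_coefD (g0 d n) P Q (gD d n)). Qed.

Let size_CM c P : (size (c%:P * P)%R <= size P)%N.
Proof. by apply/leq_sizeP => i Pi; rewrite coefCM nth_default ?mulr0. Qed.

Lemma actXl P d n : act ('X%:P * P) d n = act P d (n - e1).
Proof.
rewrite /act (@sum_coef_widen _ _ (g d n) _ _ (size P)) //.
by apply: eq_bigr => j _; rewrite coefCM gMX.
Qed.

Lemma actCl a P d n : act (a%:P%:P * P) d n = a * act P d n.
Proof.
rewrite /act (@sum_coef_widen _ _ (g d n) _ _ (size P)) //.
by rewrite mulr_sumr; apply: eq_bigr => j _; rewrite coefCM gC.
Qed.

Lemma actXr P d n : act (P * 'X) d n = act P d (n - e2).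
Proof.
rewrite /act (@sum_coefMX _ _ (g d n)) //.
apply: eq_bigr => j _; apply: eq_bigr => i _.
by rewrite mulrS addrCA [in LHS]opprD addrA.
Qed.

Lemma act1 d n : act 1 d n = d n.
Proof.
rewrite /act size_poly1 big_ord1 coefC /= size_poly1 big_ord1 coefC /= mul1r.
by rewrite !mulr0n addr0 subr0.
Qed.

(** Both sides are additive in [P]; inductions on [P] and on its coefficients leave only
    multiplication by a variable or a constant. *)
Lemma actM P Q d n : act (P * Q) d n = act P (act Q d) n.
Proof.
elim/poly_ind: P n => [|P c IHP] n; first by rewrite mul0r !act0.
rewrite mulrDl !actD mulrAC !actXr IHP; congr (_ + _).
elim/poly_ind: c n => [|c a IHc] n; first by rewrite !mul0r !act0.
rewrite polyCD mulrDl !actD polyCM [c%:P * _]mulrC -mulrA !actXl IHc; congr (_ + _).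
by rewrite -[X in act X (act Q d) n]mulr1 !actCl act1.
Qed.

Lemma act_zero P d n : d =1 (fun=> 0) -> act P d n = 0.
Proof.
by move=> d0; apply: big1 => j _; apply: big1 => i _; rewrite d0 mulr0.
Qed.

Lemma act_shift P d v n : act P (fun m => d (m - v)) n = act P d (n - v).
Proof.
by apply: eq_bigr => j _; apply: eq_bigr => i _; rewrite (addrAC n).
Qed.

Definition monomial a i j : {poly {poly R}} := a%:P%:P * ('X%:P ^+ i * 'X^j).

Lemma act_monomial a i j d n :
  act (monomial a i j) d n = a * d (n - (e1 *+ i + e2 *+ j)).
Proof.
rewrite actCl; congr (_ * _).
elim: i n => [|i IHi] n.
  rewrite expr0 mul1r mulr0n add0r; elim: j n => [|j IHj] n.
    by rewrite expr0 act1 mulr0n subr0.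
  by rewrite exprSr actXr IHj mulrS opprD addrA.
by rewrite exprS -mulrA actXl IHi mulrS -(addrA e1) [in RHS]opprD addrA.
Qed.

Variables x y : G -> int.
Hypothesis coordE : forall v, v = e1 *~ x v + e2 *~ y v.

Definition nonneg_shift s (S : seq (R * G)) :=
  all (fun z => (0 <= x z.2 + s%:Z) && (0 <= y z.2 + s%:Z)) S.

Lemma nonneg_shift_ex S : exists s, nonneg_shift s S.
Proof.
elim: S => [|z S [s Ss]]; first by exists 0%N.
exists (s + `|(x z.2)%R| + `|(y z.2)%R|)%N; rewrite /nonneg_shift /=.
apply/andP; split; first by lia.
by apply: sub_all Ss => t /andP[? ?]; apply/andP; split; lia.
Qed.

(* The polynomial of the combination [S] of vectors, translated by [s] to have
   non-negative exponents and then dilated by [k]. *)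
Definition poly_of k s (S : seq (R * G)) : {poly {poly R}} :=
  \sum_(z <- S)
     monomial z.1 (`|(x z.2 + s%:Z)%R| * k)%N (`|(y z.2 + s%:Z)%R| * k)%N.

Lemma act_poly_of k s S d n : nonneg_shift s S ->
  act (poly_of k s S) d n =
  \sum_(z <- S) z.1 * d (n - (e1 + e2) *+ s *+ k - z.2 *+ k).
Proof.
rewrite /poly_of; elim: S => [|z S IH] /=; first by rewrite !big_nil act0.
move=> /andP[/andP[x0 y0] /IH IHS]; rewrite !big_cons actD IHS act_monomial.
congr (_ * d _ + _); rewrite -addrA -opprD !mulrnA -!mulrnDl; congr (_ - _ *+ k).
rewrite (pmulrn e1) (pmulrn e2) !gez0_abs // !mulrzDr addrACA -coordE addrC.
by rewrite -!pmulrn mulrnDl.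
Qed.

End Action.

(** If [P] annihilates [d], so does [P ^+ q], which by Frobenius is [P] with exponents multiplied by
    [q]; coefficients in the prime field are fixed. *)
Lemma relation_dilate_Fp q (G : zmodType) (e1 e2 : G) (x y : G -> int)
    (S : seq ('F_q * G)) (d : G -> 'F_q) : prime q ->
    (forall v, v = e1 *~ x v + e2 *~ y v) ->
    (forall n, \sum_(z <- S) z.1 * d (n - z.2) = 0) ->
  forall n, \sum_(z <- S) z.1 * d (n - z.2 *+ q) = 0.
Proof.
move=> q_pr coordE Sd n; have [s Ss] := nonneg_shift_ex x y S.
have charFF : q \in [pchar {poly {poly 'F_q}}] by rewrite !pchar_poly pchar_Fp.
pose P := poly_of x y 1 s S.
have Pd m : act e1 e2 P d m = 0.
  by rewrite (act_poly_of coordE) //; under eq_bigr do rewrite mulr1n; exact: Sd.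
have PqE : P ^+ q = poly_of x y q s S.
  rewrite -(pFrobenius_autE charFF) rmorph_sum; apply: eq_bigr => z _.
  rewrite /monomial !rmorphM /= !pFrobenius_autE !muln1 -!exprM; congr (_ * _).
  by rewrite -[z.1]natr_Zp !polyC_natr -(pFrobenius_autE charFF) pFrobenius_aut_nat.
have := @actM _ _ e1 e2 (P ^+ q.-1) P d (n + (e1 + e2) *+ s *+ q).
rewrite [RHS]act_zero // -exprSr prednK ?prime_gt0 // PqE (act_poly_of coordE) //.
by rewrite addrK.
Qed.

(** * Periodic solutions without line factors *)

Lemma Z2_mulz (v : Z2) z : v *~ z = (v.1 * z, v.2 * z).
Proof.
rewrite [LHS]surjective_pairing; congr pair.
  by rewrite (raddfMz (@fst int int)) -mulrzr intz.
by rewrite (raddfMz (@snd int int)) -mulrzr intz.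
Qed.

Lemma Z2_mulrnI (v : Z2) : v != 0 -> injective (GRing.natmul v).
Proof.
case: v => a b v0 i j; rewrite !pmulrn !Z2_mulz => -[aij bij].
have [a0|a0] := eqVneq a 0; last by move/(mulfI a0): aij => -[].
by have [b0|b0] := eqVneq b 0; [rewrite a0 b0 eqxx in v0 | move/(mulfI b0): bij => -[]].
Qed.

Lemma primitive_basis (w : Z2) : w != 0 ->
  exists e1 e2 : Z2, exists x y : Z2 -> int, exists k,
    [/\ (0 < k)%N, w = e1 *+ k & forall v, v = e1 *~ x v + e2 *~ y v].
Proof.
case: w => a b w0; pose k := gcdn `|a| `|b|.
have k0 : (0 < k)%N.
  rewrite gcdn_gt0 !absz_gt0; apply: contraNT w0.
  by rewrite negb_or !negbK => /andP[/eqP-> /eqP->].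
have [a' aE] : exists a', a = a' * k%:Z.
  by apply/dvdzP; rewrite dvdzE /= dvdn_gcdl.
have [b' bE] : exists b', b = b' * k%:Z.
  by apply/dvdzP; rewrite dvdzE /= dvdn_gcdr.
have [u [v uvE]] := Bezoutz a b.
have uv1 : u * a' + v * b' = 1.
  apply: (@mulIf _ k%:Z); first by rewrite eqz_nat -lt0n.
  by rewrite mul1r -[RHS]/(gcdz a b) -uvE aE bE; ring.
(* [(- v, u)] completes the primitive vector [(a', b')] to a basis of determinant
   [u * a' + v * b' = 1]; Cramer's rule gives the coordinates. *)
exists (a', b'), (- v, u), (fun n => n.1 * u + n.2 * v), (fun n => a' * n.2 - b' * n.1), k.
split=> //; first by rewrite pmulrn Z2_mulz aE bE.
move=> [m n]; rewrite !Z2_mulz; congr pair => /=.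
  by rewrite -[LHS]mulr1 -uv1; ring.
by rewrite -[LHS]mulr1 -uv1; ring.
Qed.

Section LaurentOfPoly.
Variables (p : nat) (e1 e2 : Z2).
Implicit Types (P : {poly {poly 'F_p}}) (d : config p).

(** The polynomial 1 as a configuration: multiplying it by a Laurent polynomial reads off the
    coefficients. *)
Definition delta : config p := fun n => (n == 0)%:R.

Definition poly_exponents P v : {fset Z2} :=
  let s := flatten [seq [seq e1 *+ i + e2 *+ j - v | i <- iota 0 (size (P`_j)%R)]
                   | j <- iota 0 (size P)] in
  [fset z in s]%fset.

Lemma mem_poly_exponents P v i j : (j < size P)%N -> (i < size (P`_j)%R)%N ->
  e1 *+ i + e2 *+ j - v \in poly_exponents P v.
Proof.
move=> jP iP; rewrite inE /=; apply/flatten_mapP; exists j.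
  by rewrite mem_iota.
by apply/mapP; exists i; rewrite ?mem_iota.
Qed.

(** [P] evaluated at the monomials with exponents [e1] and [e2], then translated by [- v]. *)
Definition laurent_of P v : laurent p :=
  [fsfun n in poly_exponents P v => act e1 e2 P delta (n + v) | 0].

Lemma laurent_ofE P v n : laurent_of P v n = act e1 e2 P delta (n + v).
Proof.
rewrite fsfunE; case: ifPn => // nP; symmetry; rewrite /act big1 // => j _.
rewrite big1 // => i _; rewrite /delta; case: eqP => [/eqP|_]; last by rewrite mulr0.
rewrite subr_eq0 => /eqP nE; move: nP.
by rewrite -[n](addrK v) nE mem_poly_exponents.
Qed.

Lemma finsupp_laurent_of P v n : n \in finsupp (laurent_of P v) ->
  exists i j, (j < size P)%N /\ n = e1 *+ i + e2 *+ j - v.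
Proof.
rewrite mem_finsupp fsfunE; case: ifPn => [|_]; last by rewrite eqxx.
rewrite inE /= => /flatten_mapP[j]; rewrite mem_iota => /= jP /mapP[i _ ->] _.
by exists i, j.
Qed.

Lemma formal_mul_laurent_of P v d n :
  formal_mul (laurent_of P v) d n = act e1 e2 P d (n + v).
Proof.
rewrite /formal_mul (big_fset_incl _ (B := poly_exponents P v)) /=; first last.
- by move=> k _; rewrite memNfinsupp => /eqP ->; rewrite mul0r.
- apply/fsubsetP => k; rewrite mem_finsupp fsfunE.
  by case: ifP => // _; rewrite eqxx.
under eq_bigr => k _ do rewrite laurent_ofE /act mulr_suml.
rewrite exchange_big; apply: eq_bigr => j _ /=.
under eq_bigr => k _ do rewrite mulr_suml.
rewrite exchange_big; apply: eq_bigr => i _ /=.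
set w := _ + _ *+ j.
have wA : w - v \in poly_exponents P v by apply: mem_poly_exponents.
rewrite (bigD1_seq (w - v)) ?fset_uniq //= big1 => [|k kw].
  by rewrite /delta subrK subrr eqxx mulr1 addr0 opprB addrA addrAC.
rewrite /delta subr_eq0 -(inj_eq (addIr (- v))) addrK (negPf kw).
by rewrite mulr0 mul0r.
Qed.

End LaurentOfPoly.

(** With [w = e1 *+ k], period [w] means annihilation by X^k - 1. Since [f] shares no factor with
    it, [common_factor_or_in_ideal] yields a period [e2 *+ b], and the lattice generated by it and
    [w] contains a multiple of [u]. *)
Lemma period_of_no_line_factor p (f : laurent p) (d : config p) (w u : Z2) :
    prime p -> w != 0 -> (forall g, ~ line_factor f w g) ->
    solution_space f d -> period w d ->
  exists2 b, (0 < b)%N & period (u *+ b) d.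
Proof.
move=> p_pr w0 no_factor fd dw.
have [e1 [e2 [x [y [k [k0 wE coordE]]]]]] := primitive_basis w0.
pose S := [seq (f v, v) | v <- finsupp f].
have [s Ss] := nonneg_shift_ex x y S; pose t := (e1 + e2) *+ s.
pose F := poly_of x y 1 s S.
have FE c n : act e1 e2 F c n = formal_mul f c (n - t).
  rewrite (act_poly_of coordE) // /S big_map; apply: eq_bigr => v _ /=.
  by rewrite !mulr1n.
have P0 : 'X^k - 1 != 0 :> {poly 'F_p} by rewrite -size_poly_gt0 size_XnsubC.
have [[D [H [D1 DP FDH]]]|[a [b [b0 [A [B AB]]]]]] :=
  common_factor_or_in_ideal F (pchar_Fp p_pr) P0; last first.
  have Fd : act e1 e2 F d =1 fun=> 0 by move=> m; rewrite FE fd.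
  have Pd : act e1 e2 ('X^k - 1)%:P d =1 fun=> 0.
    move=> m.
    have -> : ('X^k - 1)%:P = monomial 1 k 0 + monomial (-1) 0 0 :> {poly {poly 'F_p}}.
      by rewrite /monomial !expr0 !mulr1 mul1r rmorphB rmorphXn /= !polyC1 !rmorphN.
    by rewrite actD !act_monomial !mulr0n !addr0 ?subr0 mul1r mulN1r -wE dw subrr.
  have e2b : period (e2 *+ b) d.
    move=> n; apply/eqP; rewrite -subr_eq0.
    (* Evaluating at [n + e2 *+ a] undoes the translation by Y^a. *)
    have: act e1 e2 (A * F + B * ('X^k - 1)%:P) d (n + e2 *+ a) = 0.
      by rewrite actD !actM !act_zero ?addr0.
    rewrite -AB.
    have -> : 'X^a * ('X^b - 1) =
        monomial 1 0 (a + b)%N + monomial (-1) 0 a :> {poly {poly 'F_p}}.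
      by rewrite /monomial mulrBr mulr1 -exprD !expr0 !mul1r !rmorphN /= mulN1r.
    rewrite actD !act_monomial !mulr0n !add0r mul1r mulN1r addrK.
    by rewrite mulrnDr opprD addrA addrK => ->.
  (* The factor [k] makes the [e1]-part of [u] a multiple of [w], and [b] makes its [e2]-part a
     multiple of [e2 *+ b]. *)
  exists (k * b)%N; first by rewrite muln_gt0 k0.
  rewrite [u]coordE mulrnDl; apply: periodD.
    rewrite mulrnA [_ *~ _ *+ k]pmulrn -mulrzA mulrC mulrzA -pmulrn -wE.
    by apply/periodMn/periodMz.
  rewrite mulnC mulrnA [_ *~ _ *+ b]pmulrn -mulrzA mulrC mulrzA -pmulrn.
  by apply/periodMn/periodMz.
(* The common factor [D], a polynomial in X alone, would be a line factor of [f] in direction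
   [w]. *)
exfalso; apply: (no_factor (laurent_of e1 e2 D%:P 0)).
have D0 : D != 0 by rewrite -size_poly_gt0 ltnW.
have e10 : e1 != 0 by apply: contraNneq w0 => e10; rewrite wE e10 mul0rn.
have gE i : laurent_of e1 e2 D%:P 0 (e1 *+ i) = D`_i.
  rewrite laurent_ofE /act size_polyC D0 big_ord1 coefC /= mulr0n.
  rewrite (@sum_coef_widen _ _
    (fun l c => c * delta p (e1 *+ i + 0 - (e1 *+ l + 0))) _ D
    (maxn (size D) i.+1)); last 2 first.
  - by move=> l; rewrite mul0r.
  - exact: leq_maxl.
  have iN : (i < maxn (size D) i.+1)%N by rewrite leq_maxr.
  rewrite (bigD1 (Ordinal iN)) //= big1 => [|l li].
    by rewrite /delta !addr0 subrr eqxx mulr1.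
  rewrite /delta !addr0 subr_eq0 (inj_eq (Z2_mulrnI e10)) eq_sym.
  by rewrite -[i]/(val (Ordinal iN)) (inj_eq val_inj) (negPf li) mulr0.
split; last first.
  (* The cofactor is [H] translated back by [t]; coefficients are compared by letting [F] act on
     [delta]. *)
  exists (laurent_of e1 e2 H t); apply/fsfunP => n.
  rewrite laurent_mulE formal_mul_laurent_of addr0.
  have -> : (laurent_of e1 e2 H t : config p) = fun m => act e1 e2 H (delta p) (m - - t).
    by apply/funext => m; rewrite laurent_ofE opprK.
  rewrite act_shift opprK -actM -FDH FE addrK /formal_mul.
  have [nf|nf] := boolP (n \in finsupp f).
    rewrite (bigD1_seq n) ?fset_uniq //= big1 => [|v vn].
      by rewrite /delta subrr eqxx mulr1 addr0.
    by rewrite /delta subr_eq0 eq_sym (negPf vn) mulr0.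
  rewrite fsfun_dflt // big_seq big1 // => v vf.
  by rewrite /delta subr_eq0; case: eqP => [nv|_]; [rewrite nv vf in nf | rewrite mulr0].
split=> //.
  (* [D] divides X^k - 1, whose constant term is non-zero; its own constant and leading terms then
     give two support points. *)
  have D00 : D`_0 != 0.
    have [C PC] := dvdpP _ _ DP; apply/eqP => D00.
    have := congr1 (fun q : {poly 'F_p} => q`_0) PC.
    rewrite coef0M D00 mulr0 coefB coefXn coefC /= (ltn_eqF k0) sub0r.
    by move/eqP; rewrite oppr_eq0 oner_eq0.
  pose m := e1 *+ (size D).-1.
  have m0 : 0 != m.
    rewrite -(mulr0n e1) (inj_eq (Z2_mulrnI e10)) eq_sym -lt0n.
    by rewrite -ltnS prednK // ltnW.
  have sub : ([fset 0%R; m] `<=` finsupp (laurent_of e1 e2 (D%:P)%R 0%R))%fset.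
    apply/fsubsetP => v; rewrite !inE mem_finsupp => /orP[]/eqP ->.
      by rewrite -(mulr0n e1) gE.
    by rewrite gE -lead_coefE lead_coef_eq0.
  by have := fsubset_leq_card sub; rewrite cardfs2 m0.
exists 0 => m /finsupp_laurent_of [i [j [+ ->]]].
rewrite size_polyC; case: (D != 0); rewrite ?ltnS ?leqn0 // => /eqP ->.
exists (i%:Q / k%:Q); rewrite mulr0n addr0 subr0 wE !add0r.
have kQ : k%:Q != 0 by rewrite intr_eq0 eqz_nat -lt0n.
by rewrite !pmulrn !Z2_mulz /= !intrM; split; field.
Qed.

(** * Integer relations *)

(** With more rows than columns, the rows satisfy a non-trivial rational relation; the product [N]
    of its denominators makes it integral. *)
Lemma int_kernel (I T : finType) (A : {set T}) (M : I -> T -> int) :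
    (#|A| < #|I|)%N ->
  exists2 b : I -> int, exists i, b i != 0 &
    forall s, s \in A -> \sum_i b i * M i s = 0.
Proof.
move=> AI.
pose B := \matrix_(i < #|I|, j < #|A|) ((M (enum_val i) (enum_val j))%:~R : rat).
have /rowV0Pn[v /sub_kermxP vB v0] : kermx B != 0.
  by rewrite -mxrank_eq0 mxrank_ker subn_eq0 -ltnNge (leq_ltn_trans (rank_leq_col B)).
pose a i := v 0 (enum_rank i).
pose N := \prod_i denq (a i).
have N0 : N != 0 by rewrite prodf_seq_neq0; apply/allP => i _; rewrite denq_neq0.
pose b i := numq (a i) * \prod_(j | j != i) denq (a j).
have bE i : (b i)%:~R = a i * N%:~R.
  have -> : N = denq (a i) * \prod_(j | j != i) denq (a j) by rewrite /N (bigD1 i).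
  by rewrite /b !intrM numqE mulrA.
have NQ : (N%:~R : rat) != 0 by rewrite intr_eq0.
exists b.
  have /rV0Pn[j vj] := v0.
  exists (enum_val j); rewrite -(intr_eq0 rat) bE mulf_eq0 negb_or NQ andbT.
  by rewrite /a enum_valK.
move=> s sA; apply/eqP; rewrite -(intr_eq0 rat) rmorph_sum /=.
have := congr1 (fun m : 'rV_#|A| => m 0 (enum_rank_in sA s)) vB.
rewrite mxE mxE => vBs.
suff -> : \sum_i (b i * M i s)%:~R = N%:~R * \sum_j v 0 j * B j (enum_rank_in sA s).
  by rewrite vBs mulr0.
rewrite mulr_sumr (reindex _ (onW_bij _ (enum_val_bij I))) /=.
apply: eq_bigr => j _; rewrite intrM bE mxE enum_rankK_in // /a enum_valK.
by rewrite mulrAC mulrC.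
Qed.

(** The dilated sum vanishes modulo [q] by [relation_dilate_Fp], and its absolute value is below
    [q]. *)
Lemma relation_dilate_prime (S : seq (int * Z2)) (c : Z2 -> int) (K : int) q :
    prime q -> (forall n, `|c n| <= K) -> (\sum_(z <- S) `|z.1|) * K < q%:Z ->
    (forall n, \sum_(z <- S) z.1 * c (n - z.2) = 0) ->
  forall n, \sum_(z <- S) z.1 * c (n - z.2 *+ q) = 0.
Proof.
move=> q_pr cK Kq Sc n; set t := \sum_(_ <- _) _.
have modE (m : Z2 -> Z2) :
    \sum_(z <- [seq ((z.1%:~R : 'F_q), z.2) | z <- S]) z.1 * (c (m z.2))%:~R
    = (\sum_(z <- S) z.1 * c (m z.2))%:~R.
  by rewrite big_map rmorph_sum; apply: eq_bigr => z _; rewrite /= intrM.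
have coordE (v : Z2) : v = (1, 0) *~ v.1 + (0, 1) *~ v.2.
  by case: v => a b; rewrite !Z2_mulz /= !mul1r !mul0r; congr pair; rewrite ?addr0 ?add0r.
have t0 : (t%:~R : 'F_q) = 0.
  rewrite /t -(modE (fun v => n - v *+ q)).
  apply: (@relation_dilate_Fp q _ _ _ _ _ _ (fun m => (c m)%:~R) q_pr coordE) => m.
  by rewrite (modE (fun v => m - v)) Sc.
have qt : (q %| t)%Z by rewrite (dvdz_pcharf (pchar_Fp q_pr)) t0.
have tq : `|t| < q%:Z.
  apply: le_lt_trans Kq; rewrite (le_trans (ler_norm_sum _ _ _)) // mulr_suml.
  by apply: ler_sum => z _; rewrite normrM ler_wpM2l.
have [a tE] := dvdzP qt; rewrite tE in tq *.
move: tq; rewrite normrM => /= tq.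
have [->|a0] := eqVneq a 0; first by rewrite mul0r.
have := prime_gt0 q_pr; nia.
Qed.

(** The prime factors of [m] are applied one at a time; dilation keeps the coefficients, hence the
    bound each prime must exceed. *)
Lemma relation_dilate (S : seq (int * Z2)) (c : Z2 -> int) (K : int) m :
    (0 < m)%N -> (forall n, `|c n| <= K) ->
    (forall q, prime q -> (q %| m)%N -> (\sum_(z <- S) `|z.1|) * K < q%:Z) ->
    (forall n, \sum_(z <- S) z.1 * c (n - z.2) = 0) ->
  forall n, \sum_(z <- S) z.1 * c (n - z.2 *+ m) = 0.
Proof.
move=> + cK; have [k] := ubnP m; elim: k m => // k IH m /ltnSE mk m0 Km Sc n.
have [m1|m1] := leqP m 1.
  by have -> : m = 1%N by lia; exact: Sc.
have q_pr := pdiv_prime m1; set q := pdiv m in q_pr.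
have qm : (q %| m)%N := pdiv_dvd m; set l := (m %/ q)%N.
have mE : m = (l * q)%N by rewrite divnK.
have q1 := prime_gt1 q_pr.
have lm : (l %| m)%N by rewrite mE dvdn_mulr.
have Sl := IH l _ _ _ Sc.
have {}Sl : forall n, \sum_(z <- [seq (z.1, z.2 *+ l) | z <- S]) z.1 * c (n - z.2) = 0.
  move=> n'; rewrite big_map Sl //; [nia | nia | ].
  by move=> q' q'_pr q'l; apply: Km => //; apply: dvdn_trans lm.
have := relation_dilate_prime q_pr cK _ Sl n; rewrite !big_map => Sq.
rewrite -[RHS](Sq (Km q q_pr qm)) mE.
by apply: eq_bigr => z _; rewrite mulrnA.
Qed.

Lemma diffs_scale_shift (G : zmodType) (R : nzRingType) (ws : seq G)
    (a : R) v (c : G -> R) n :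
  diffs ws (fun n => a * c (n - v)) n = a * diffs ws c (n - v).
Proof.
elim: ws c n => //= w ws IH c n; rewrite -IH; congr (diffs ws _ n).
by apply/funext => m; rewrite /diff mulrBr addrAC.
Qed.

Lemma relation_diffs (S : seq (int * Z2)) (c : Z2 -> int) (K a : int) (v : Z2) :
    (forall n, `|c n| <= K) -> a != 0 -> v \notin [seq z.2 | z <- S] ->
    (forall n, \sum_(z <- (a, v) :: S) z.1 * c (n - z.2) = 0) ->
  exists2 ws : seq Z2, 0 \notin ws & diffs ws c =1 fun=> 0.
Proof.
move=> cK a0 vS Sc.
(* All primes up to [N] divide [r = N!], so every prime factor of [1 + r * k] exceeds [N]. *)
pose N := `|((\sum_(z <- (a, v) :: S) `|z.1|) * K)%R|%N; pose r := N`!.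
pose S' := [seq ((fun n => z.1 * c (n - z.2)), z.2 *+ r) | z <- S].
exists [seq v *+ r - x.2 | x <- S'].
  apply/mapP => -[x /mapP[z zS ->] /esym/eqP]; rewrite subr_eq0 /=; apply/negP.
  rewrite -subr_eq0 -mulrnBl -[0](mulr0n (v - z.2)) (inj_eq (Z2_mulrnI _)).
    by rewrite -lt0n fact_gt0.
  by rewrite subr_eq0; apply: contra vS => /eqP ->; apply: map_f.
have Sk k n : \sum_(z <- (a, v) :: S) z.1 * c (n - z.2 *+ (1 + r * k)) = 0.
  apply: relation_dilate cK _ Sc n => // q q_pr qm.
  have : (N < q)%N.
    rewrite ltnNge; apply/negP => qN.
    have qr : (q %| r * k)%N by rewrite dvdn_mulr // dvdn_fact // prime_gt0.
    by move: qm; rewrite dvdn_addl // dvdn1 => /eqP q1; rewrite q1 in q_pr.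
  by rewrite /N; lia.
(* As [k] grows by one, the term of each [z] is translated by [z.2 *+ r]: the progression that
   [vandermonde_elimination] requires. *)
have H : diffs [seq v *+ r - x.2 | x <- S'] (fun n => a * c (n - v)) =1 fun=> 0.
  apply: vandermonde_elimination => k n; rewrite big_map -[RHS](Sk k n) big_cons /=.
  have shift w : n - w *+ r *+ k - w = n - w *+ (1 + r * k).
    by rewrite mulrnDr mulr1n mulrnA opprD addrA addrAC.
  by rewrite shift; congr (_ + _); apply: eq_bigr => z _; rewrite shift.
move=> n; have := H (n + v); rewrite diffs_scale_shift addrK => /eqP.
by rewrite mulf_eq0 (negPf a0) => /eqP.
Qed.

(** * Low complexity *)

Lemma diffs_additive (G U V : zmodType) (h : {additive U -> V})
    (ws : seq G) (c : G -> U) n :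
  diffs ws (fun n => h (c n)) n = h (diffs ws c n).
Proof.
elim: ws c n => //= w ws IH c n; rewrite -IH; congr (diffs ws _ n).
by apply/funext => m; rewrite /diff raddfB.
Qed.

Lemma low_complexity_diffs p (c : config p) : low_complexity c ->
  exists2 ws : seq Z2, 0 \notin ws & diffs ws c =1 fun=> 0.
Proof.
(* [l] lifts the values to non-negative integers; passing to the difference [c'] will cancel the
   constant of the relation. *)
move=> [D cD]; pose l n : int := (c n : nat)%:Z; pose c' := diff (1, 0) l.
(* The extra coordinate, constantly 1, makes the coordinates outnumber the patterns and carries the
   constant term. *)
pose M (i : D + unit) (s : {ffun D -> 'F_p})  : int :=
  if i is inl v then (s v : nat)%:Z else 1.
have [|b [i bi] bM] := @int_kernel _ _ (patterns c D) M.
  by rewrite card_sum card_unit addn1 -cardfE ltnS.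
have bl n : \sum_(v : D) b (inl v) * l (n + val v) = - b (inr tt).
  apply/eqP; rewrite -addr_eq0; apply/eqP.
  have /bM : pattern_at c D (- n) \in patterns c D.
    by rewrite inE; apply/asboolP; exists (- n).
  have -> : b (inr tt) = \sum_i b (inr i) * 1.
    by rewrite (bigD1 tt) //= big1 ?addr0 ?mulr1 // => -[].
  rewrite big_sumType /= => bs; rewrite -[RHS]bs.
  by congr (_ + _); apply: eq_bigr => v _; rewrite ffunE /translate opprK addrC.
(* If all coefficients on [D] vanished, [bl] would make the constant vanish too. *)
have [v bv] : exists v, b (inl v) != 0.
  case: i bi => [v|[]] bi; first by exists v.
  apply: contrapT => nb; case/eqP: bi; apply/eqP; rewrite -oppr_eq0 -(bl 0) big1 // => v _.
  by have [->|bv] := eqVneq (b (inl v)) 0; [rewrite mul0r | case: nb; exists v].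
pose S := [seq (b (inl v'), - val v') | v' <- index_enum {: D} & v' != v].
(* The bound is the size of ['F_p] as an ordinal type, which exceeds any difference of two lifted
   values. *)
have [||n|ws ws0 wsc] := @relation_diffs S c' (Zp_trunc (pdiv p)).+2%:Z _ (- val v) _ bv.
- have lK m : 0 <= l m < (Zp_trunc (pdiv p)).+2%:Z by rewrite /l ltz_nat ltn_ord.
  have dist (x y K : int) : 0 <= x < K -> 0 <= y < K -> `|x - y| <= K by lia.
  by move=> n; exact: dist.
- apply/mapP => -[_ /mapP[v' + ->] /= /oppr_inj/val_inj vv'].
  by rewrite mem_filter vv' eqxx.
- rewrite big_cons big_map big_filter /=.
  have := bl n; rewrite -(bl (n - (1, 0))) => /esym/eqP; rewrite -subr_eq0 -sumrB.
  rewrite (bigD1 v) //= => /eqP bln; rewrite -[RHS]bln /c' /diff opprK mulrBr (addrAC n).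
  congr (_ + _); apply: eq_bigr => v' _.
  by rewrite opprK mulrBr (addrAC n).
exists ((1, 0) :: ws); first by rewrite inE negb_or.
move=> n.
have -> : c = fun n => intmul 1 (l n).
  by apply/funext => m; rewrite /l -pmulrn natr_Zp.
by rewrite (diffs_additive (intmul (1 : 'F_p))) /= wsc.
Qed.

Lemma solution_space_diff p (f : laurent p) (c : config p) w :
  solution_space f c -> solution_space f (diff w c).
Proof.
move=> fc n; have := fc (n - w); rewrite -[RHS](fc n) => /eqP.
rewrite -subr_eq0 -sumrB => /eqP fcn; rewrite -[RHS]fcn.
by apply: eq_bigr => k _; rewrite /diff mulrBr (addrAC n).
Qed.

Lemma period_same_direction (V : zmodType) (u w : Z2) (c : Z2 -> V) :
  same_direction u w -> period w c -> exists2 b, (0 < b)%N & period (u *+ b) c.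
Proof.
move=> [r [r0 w1 w2]] cw.
have E : w *~ denq r = u *~ numq r.
  rewrite !Z2_mulz; congr pair; apply: (@intr_inj rat).
    by rewrite !intrM w1 numqE; ring.
  by rewrite !intrM w2 numqE; ring.
exists `|numq r|%N; first by rewrite absz_gt0 numq_eq0.
have : period (u *~ numq r) c by rewrite -E; apply: periodMz.
rewrite pmulrn abszE; case: (ger0P (numq r)) => // _.
by rewrite mulrNz; apply: periodN.
Qed.

Theorem corollary9 (p : nat) (p_prime : prime p) (f : laurent p)
    (f_neq0 : f <> laurent0 p)
    (f_dir : line_factors_same_direction f)
    (c : config p) (fc0 : solution_space f c)
    (c_low : low_complexity c) :
  periodic c.
Proof.
have [ws ws0 wsc] := low_complexity_diffs c_low.
(* Without line factors, any non-zero [u] serves as the common direction. *)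
have [u u0 uP] : exists2 u : Z2, u != 0 &
    forall w g, line_factor f w g -> same_direction u w.
  case: (pselect (exists u g, line_factor f u g)) => [[u [g ug]]|no_factor].
    by exists u => [|w h]; [case: ug => -[] | apply: f_dir ug].
  by exists (1, 0) => // w g wg; case: no_factor; exists w, g.
have [||w d ww fd dw|||b b0 cb] :=
  @diffs_period _ _ p (solution_space f) u ws c (prime_gt0 p_prime).
- by move=> x; rewrite -mulr_natr pchar_Fp_0 // mulr0.
- by move=> w d; apply: solution_space_diff.
- case: (pselect (exists g, line_factor f w g)) => [[g wg]|no_factor].
    exact: period_same_direction (uP w g wg) dw.
  apply: (period_of_no_line_factor _ p_prime _ _ fd dw).
    by apply: contraNneq ws0 => <-.
  by move=> g wg; apply: no_factor; exists g.
- exact: fc0.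
- exact: wsc.
exists (u *+ b) => //; rewrite -[0](mulr0n u) (inj_eq (Z2_mulrnI u0)).
by rewrite -lt0n.
Qed.
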